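(* For $\lambda\in(0,1)$ and $r\in[-1,1]\setminus\{0\}$, let $f_{r,\lambda}(x)=[1-\lambda+\lambda x^r]^{1/r}$. Assume that $T=U|T|\in\mathcal{B}(H)$ is invertible and centered. If $T\in\mathcal{K}(H)$ or $T$ is an $n\times n$ matrix, then $\lim_{n\to\infty}\Delta_{f_{r,\lambda}}^n(T)$ exists. Moreover, the limit point does not depend on $\lambda$.
   Context: $H$ is a complex Hilbert space, $\mathcal{B}(H)$ the bounded operators, $\mathcal{K}(H)$ the compact operators on $H$, $|T|=(T^*T)^{1/2}$; limits of operators are in the strong operator topology. If $T$ is invertible, $U$ in the polar decomposition $T=U|T|$ is unitary. The functions $f=f_{r,\lambda}$ are representing functions of operator means (power means): operator monotone on $(0,\infty)$ with $f(1)=1$. Induced Aluthge transformation: for invertible $T=U|T|$ with spectral decomposition $|T|=\int_{\sigma(|T|)}s\,dE_s$, define $\Delta_f(T):=\int_{\sigma(|T|)}\int_{\sigma(|T|)} s f(t/s)\,dE_s\,U\,dE_t$ (double operator integral). Concretely (known fact), if $\mu$ is a probability measure on $[0,1]$ with $f(x)=\int_0^1[1-\theta+\theta x^{-1}]^{-1}d\mu(\theta)$ for $x>0$ (such $\mu$ exists), then $\Delta_f(T)=\int_0^1\int_0^\infty e^{-(1-\theta)s|T|^{-1}}\,U\,e^{-\theta s|T|^{-1}}\,ds\,d\mu(\theta)$. Iterates: $\Delta_f^0(T)=T$, $\Delta_f^n(T)=\Delta_f(\Delta_f^{n-1}(T))$. $T=U|T|$ is centered if $\{U^{*m}|T|U^m,\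 |T|,\ U^n|T|U^{*n}: n,m=1,2,\dots\}$ is a commuting set. *)

(* Defs.v *)
From HB Require Import structures.
From mathcomp Require Import all_boot all_order all_algebra.
From mathcomp Require Import sesquilinear complex.
From mathcomp Require Import all_classical all_reals all_analysis.

Set Implicit Arguments.
Unset Strict Implicit.
Unset Printing Implicit Defensive.

Import Order.TTheory GRing.Theory Num.Theory.
Import numFieldNormedType.Exports.

Local Open Scope classical_set_scope.
Local Open Scope ring_scope.
Local Open Scope complex_scope.

(* A complex Hilbert space is a complete normed module H over R[i] together
   with a positive definite Hermitian form [dot] (linear in its first argument,
   conjugate-linear in the second) inducing the norm, see [hilbert]. Operators
   are functions H -> H, so that Leibniz equality is equality of operators. *)
Section Operators.
Context {R : realType} {H : completeNormedModType R[i]}.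
Variable dot : {dot H for (@Num.conj R[i])}.

Definition hilbert := forall x : H, `|x| ^+ 2 = dot x x.

Definition bounded_op (T : H -> H) := linear T /\ continuous T.

Definition invertible_op (T : H -> H) :=
  exists S : H -> H, [/\ bounded_op S, S \o T = id & T \o S = id].

Definition compact_op (T : H -> H) :=
  compact (closure [set T x | x in [set x : H | `|x| <= 1]]).

(* H is identified with C^n by an orthonormal basis e, in which T has matrix A. *)
Definition matrix_op (T : H -> H) :=
  exists (n : nat) (e : 'I_n -> H) (A : 'M[R[i]]_n),
    [/\ forall i j, dot (e i) (e j) = (i == j)%:R,
        forall x, x = \sum_i dot x (e i) *: e i &
        forall j, T (e j) = \sum_i A i j *: e i].

(* The adjoint exists and is unique for every bounded operator. *)
Definition adjoint (T : H -> H) : H -> H :=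
  xget (fun=> 0) [set S | bounded_op S /\
                          forall x y, dot (T x) y = dot x (S y)].

Definition positive_op (P : H -> H) :=
  bounded_op P /\ forall x, 0 <= dot (P x) x.

Definition unitary_op (U : H -> H) :=
  [/\ bounded_op U, adjoint U \o U = id & U \o adjoint U = id].

(* T = U P with P = (T^* T)^(1/2), for invertible T (so that U is unitary). *)
Definition polar (T U P : H -> H) :=
  [/\ unitary_op U, positive_op P, P \o P = adjoint T \o T & T = U \o P].

Definition centered (U P : H -> H) :=
  let V := adjoint U in
  forall A B : H -> H,
    let S := [set X : H -> H | X = P \/ exists2 m : nat, (0 < m)%N &
               X = iter m V \o P \o iter m U \/
               X = iter m U \o P \o iter m V] in
    S A -> S B -> A \o B = B \o A.

Definition orth_proj (Q : H -> H) :=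
  [/\ bounded_op Q, Q \o Q = Q & forall x y, dot (Q x) y = dot x (Q y)].

(* Real spectrum; it is the whole spectrum for selfadjoint P. *)
Definition spectrum (P : H -> H) : set R :=
  [set s | ~ invertible_op (fun x => P x - s%:C *: x)].

(* A = \int_(spectrum P) a(s) dE_s in the weak sense, where nu x is the scalar
   spectral measure <E(.) x, x>; on a complex space the quadratic form
   determines A. *)
Definition spectral_integral (P : H -> H)
    (nu : H -> {measure set (measurableTypeR R) -> \bar R})
    (a : R -> R) (A : H -> H) :=
  bounded_op A /\
  forall x, dot (A x) x = (\int[nu x]_(s in spectrum P) a s)%:C.

(* E is the projection-valued measure of P, nu x is <E(.) x, x>. Countable
   additivity of E is that of the measures nu x. *)
Definition spectral_measure (P : H -> H) (E : set (measurableTypeR R) -> H -> H)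
    (nu : H -> {measure set (measurableTypeR R) -> \bar R}) :=
  [/\ forall A, measurable A -> orth_proj (E A),
      E (spectrum P) = id,
      forall A B, measurable A -> measurable B -> E (A `&` B) = E A \o E B,
      forall x A, measurable A -> (nu x A = (complex.Re (dot (E A x) x))%:E)%E &
      spectral_integral P nu idfun P].

Definition Cintegral d (W : measurableType d)
    (sigma : {measure set W -> \bar R}) (g : W -> R[i]) : R[i] :=
  (\int[sigma]_(w in setT) complex.Re (g w)) +i*
  (\int[sigma]_(w in setT) complex.Im (g w)).

(* D is the double operator integral \int \int phi(s,t) dE_s X dE_t in the sense
   of Peller and Birman-Solomyak: phi(s,t) = \int a(s,w) b(t,w) dsigma(w) on
   spectrum P x spectrum P with sigma finite and a, b bounded measurable, and
   D = \int (\int a(s,w) dE_s) X (\int b(t,w) dE_t) dsigma(w) weakly.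
   D does not depend on the factorization. As phi is real-valued, a and b may be
   taken real: split complex factors into real and imaginary parts on two
   copies of W. *)
Definition double_operator_integral (P : H -> H)
    (nu : H -> {measure set (measurableTypeR R) -> \bar R})
    (phi : R -> R -> R) (X D : H -> H) :=
  bounded_op D /\
  exists (d : measure_display) (W : measurableType d)
    (sigma : {finite_measure set W -> \bar R})
    (a b : measurableTypeR R * W -> R) (M : R) (A B : W -> H -> H),
    [/\ measurable_fun setT a, measurable_fun setT b &
        forall z, `|a z| <= M /\ `|b z| <= M] /\
    [/\ forall s t, spectrum P s -> spectrum P t ->
          phi s t = \int[sigma]_(w in setT) (a (s, w) * b (t, w)),
        forall w, spectral_integral P nu (fun s => a (s, w)) (A w),
        forall w, spectral_integral P nu (fun t => b (t, w)) (B w) &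
        forall x y, dot (D x) y = Cintegral sigma (fun w => dot (A w (X (B w x))) y)].

Definition is_aluthge (f : R -> R) (T D : H -> H) :=
  exists U P E nu, [/\ polar T U P, spectral_measure P E nu &
    double_operator_integral P nu (fun s t => s * f (t / s)) U D].

Definition aluthge (f : R -> R) (T : H -> H) : H -> H :=
  xget (fun=> 0) (is_aluthge f T).

Definition sot_cvg (T_ : nat -> H -> H) (L : H -> H) :=
  forall x, (fun n => T_ n x) @ \oo --> L x.

End Operators.

Definition power_mean {R : realType} (r lambda x : R) : R :=
  (1 - lambda + lambda * x `^ r) `^ (r^-1).

(* Main.v *)
Require Import Defs.
From HB Require Import structures.
From mathcomp Require Import all_boot all_order all_algebra all_fingroup.
From mathcomp Require Import finmap sesquilinear spectral complex.
From mathcomp Require Import all_classical all_reals all_analysis.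
From mathcomp Require Import measurable_realfun ring.

Set Implicit Arguments.
Unset Strict Implicit.
Unset Printing Implicit Defensive.

Import Order.TTheory GRing.Theory Num.Theory.
Import numFieldNormedType.Exports.
Local Open Scope classical_set_scope.
Local Open Scope ring_scope.
Local Open Scope complex_scope.

(** An invertible compact operator maps the unit ball onto a neighbourhood of 0
    with compact closure, so H has a finite orthonormal basis in both cases of
    the hypothesis ([compact_invertible_basis]).

    Because T = U P is centered, the operators A_m = U^*m P U^m, m >= 0, are
    selfadjoint and commute, hence have a common orthonormal eigenbasis e with
    A_m e_i = beta_i(m) e_i ([joint_eigenbasis]). As U A_{m+1} = A_m U, an entry
    <U e_j, e_i> can be nonzero only if beta_i(m) = beta_j(m+1) for all m; as U
    is invertible, the Leibniz formula for the determinant gives a permutation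
    tau with <U e_j, e_{tau j}> != 0 for all j, so that tau realises this shift
    on indices ([centered_eigenbasis]).

    If Q is diagonal in e with positive eigenvalues q_i, then the Aluthge
    transform of U Q has the entries q_i f(q_j / q_i) <U e_j, e_i>
    ([aluthge_diag]). Since [aluthge] chooses an arbitrary operator satisfying
    its specification, this has two halves. For existence, the spectral measure
    and a finite factorization of the symbol are written down. For uniqueness,
    the polar decomposition is unique, and against any spectral measure of Q
    a spectral integral of a function a is the diagonal operator with
    eigenvalues a(q_i) ([spectral_integral_unique]), which fixes every entry
    of the double operator integral.

    If moreover q_i depends only on the sequence beta_i, then q_i = q_{tau j}
    whenever <U e_j, e_i> != 0, and the transform of U Q is U Q' with
    q'_j = q_{tau j} f(q_j / q_{tau j}), where q' depends only on beta as well.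
    Hence all iterates are of the form U Q_n. For the power mean with exponent
    r, the numbers h = q^r satisfy the linear recurrence
    h'_j = (1 - lambda) h_{tau j} + lambda h_j. The sum of the squares of h
    drops at each step by lambda (1 - lambda) times the sum of the squares of
    h_j - h_{tau j}; these differences therefore tend to 0, while the mean of h
    over each tau-orbit is preserved, so h_j tends to that mean
    ([cvg_lazy_average]), in which lambda does not occur. *)

(** * Inner products *)

Section InnerProduct.
Context {R : realType} {H : completeNormedModType R[i]}.
Variable dot : {dot H for (@Num.conj R[i])}.

Lemma dotDl x y z : dot (x + y) z = dot x z + dot y z.
Proof. exact: linearDl. Qed.
Lemma dotDr x y z : dot x (y + z) = dot x y + dot x z.
Proof. exact: linearDr. Qed.
Lemma dotBl x y z : dot (x - y) z = dot x z - dot y z.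
Proof. exact: linearBl. Qed.
Lemma dotBr x y z : dot x (y - z) = dot x y - dot x z.
Proof. exact: linearBr. Qed.
Lemma dot0l x : dot 0 x = 0.
Proof. exact: linear0l. Qed.
Lemma dotZl a x y : dot (a *: x) y = a * dot x y.
Proof. exact: linearZl_LR. Qed.
Lemma dotZr a x y : dot x (a *: y) = (a^*)%C * dot x y.
Proof. exact: (linearZr_LR dot). Qed.
Lemma dot_suml I (s : seq I) (p : pred I) (v : I -> H) y :
  dot (\sum_(i <- s | p i) v i) y = \sum_(i <- s | p i) dot (v i) y.
Proof. exact: linear_sumlz. Qed.
Lemma dot_sumr I (s : seq I) (p : pred I) (v : I -> H) x :
  dot x (\sum_(i <- s | p i) v i) = \sum_(i <- s | p i) dot x (v i).
Proof. exact: linear_sumr. Qed.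
Lemma dotC x y : dot x y = ((dot y x)^*)%C.
Proof. by rewrite hermC expr0 mul1r. Qed.

Lemma dot_ge0 x : 0 <= dot x x.
Proof. exact: dnorm_ge0. Qed.
Lemma dot_eq0 x : dot x x = 0 -> x = 0.
Proof. by move/eqP; rewrite dnorm_eq0 => /eqP. Qed.

Lemma dot_inj x y : (forall z, dot x z = dot y z) -> x = y.
Proof.
move=> h; apply/eqP; rewrite -subr_eq0; apply/eqP/dot_eq0.
by rewrite dotBl h subrr.
Qed.

Lemma linearP_op (T : H -> H) : linear T ->
  [/\ forall x y, T (x + y) = T x + T y, forall x y, T (x - y) = T x - T y,
      forall a x, T (a *: x) = a *: T x & T 0 = 0].
Proof.
move=> lT.
have D x y : T (x + y) = T x + T y by have := lT 1 x y; rewrite !scale1r.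
have T0 : T 0 = 0 by apply: (addrI (T 0)); rewrite -D !addr0.
have Z a x : T (a *: x) = a *: T x by have := lT a x 0; rewrite T0 !addr0.
by split=> // x y; rewrite D -[in LHS]scaleN1r Z scaleN1r.
Qed.

Lemma linear_sum_op (T : H -> H) I (s : seq I) (p : pred I) (v : I -> H) :
  linear T ->
  T (\sum_(i <- s | p i) v i) = \sum_(i <- s | p i) T (v i).
Proof.
move=> /linearP_op [D _ _ T0]; exact: (big_morph T D T0).
Qed.

End InnerProduct.

(** * Operators on a finite-dimensional Hilbert space *)

Section FiniteDimension.
Context {R : realType} {H : completeNormedModType R[i]}.
Variable dot : {dot H for (@Num.conj R[i])}.
Hypothesis hH : hilbert dot.

Definition orthonormal_family (N : nat) (e : 'I_N -> H) :=
  forall i j, dot (e i) (e j) = (i == j)%:R.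

(** An orthonormal family in which every vector has its Fourier expansion. *)
Definition orthonormal_basis (N : nat) (e : 'I_N -> H) :=
  orthonormal_family e /\ (forall x, x = \sum_i dot x (e i) *: e i).

(** The operator mapping e_i to v_i, when e is an orthonormal basis. *)
Definition lincomb N (e v : 'I_N -> H) (x : H) : H := \sum_i dot x (e i) *: v i.

Lemma linear_lincomb N (e v : 'I_N -> H) : linear (lincomb e v).
Proof.
move=> a x y; rewrite /lincomb scaler_sumr -big_split /=; apply: eq_bigr => i _.
by rewrite dotDl dotZl scalerDl scalerA.
Qed.

(** The Cauchy-Schwarz inequality against a unit vector. *)
Lemma normr_dot_unit x u : dot u u = 1 -> `|dot x u| <= `|x|.
Proof.
move=> u1; rewrite -(@ler_pXn2r _ 2%N) ?nnegrE ?normr_ge0 // hH.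
have := dot_ge0 dot (x - dot x u *: u).
rewrite dotBl !dotBr !dotZl !dotZr u1 mulr1 (dotC dot u x).
rewrite [_ * (dot x u)^*%C]mulrC subrr subr0 subr_ge0.
by rewrite normCK mulrC.
Qed.

Lemma bounded_lincomb N (e v : 'I_N -> H) :
  (forall i, dot (e i) (e i) = 1) -> bounded_op (lincomb e v).
Proof.
move=> e1; split; first exact: linear_lincomb.
pose F := HB.pack_for {linear H -> H} (lincomb e v)
  (GRing.isLinear.Build _ _ _ _ (lincomb e v) (linear_lincomb e v)).
apply: (@bounded_linear_continuous _ _ _ F); apply/linear_boundedP.
near=> r => x.
apply: (le_trans (ler_norm_sum _ _ _)).
apply: (@le_trans _ _ (\sum_i `|v i| * `|x|)).
  apply: ler_sum => i _; rewrite normrZ mulrC ler_wpM2l //.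
  exact: normr_dot_unit.
rewrite -mulr_suml ler_wpM2r //.
near: r; apply: nbhs_pinfty_ge.
by apply: ger0_real; apply: sumr_ge0.
Unshelve. all: by end_near. Qed.

Section Basis.
Variables (N : nat) (e : 'I_N -> H).
Hypothesis he : orthonormal_basis e.

Let e1 i : dot (e i) (e i) = 1.
Proof. by rewrite he.1 eqxx. Qed.

Lemma lincombE v i : lincomb e v (e i) = v i.
Proof.
rewrite /lincomb (bigD1 i) //= e1 scale1r big1 ?addr0 // => j ji.
by rewrite he.1 eq_sym (negPf ji) scale0r.
Qed.

Lemma linear_basisE (T : H -> H) : linear T -> T = lincomb e (T \o e).
Proof.
move=> lT; apply/funext => x; rewrite {1}(he.2 x) linear_sum_op //.
by apply: eq_bigr => i _; have [_ _ -> _] := linearP_op lT.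
Qed.

Lemma eq_linear_basis (S T : H -> H) : linear S -> linear T ->
  (forall i, S (e i) = T (e i)) -> S = T.
Proof.
move=> lS lT ST; rewrite (linear_basisE lS) (linear_basisE lT); congr lincomb.
exact/funext.
Qed.

Lemma linear_bounded (T : H -> H) : linear T -> bounded_op T.
Proof. by move=> /linear_basisE ->; exact: bounded_lincomb. Qed.

Lemma dot_basisE x y : dot x y = \sum_i dot x (e i) * ((dot y (e i))^*)%C.
Proof.
rewrite {1}(he.2 x) dot_suml; apply: eq_bigr => i _.
by rewrite dotZl; congr (_ * _); exact: dotC.
Qed.

Lemma adjoint_exists (T : H -> H) : linear T ->
  exists S, bounded_op S /\ forall x y, dot (T x) y = dot x (S y).
Proof.
move=> lT; exists (fun y => \sum_i dot y (T (e i)) *: e i); split.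
  apply: linear_bounded => a x y.
  rewrite scaler_sumr -big_split /=; apply: eq_bigr => i _.
  by rewrite dotDl dotZl scalerDl scalerA.
move=> x y; rewrite {1}(linear_basisE lT) dot_suml dot_sumr.
apply: eq_bigr => i _; rewrite dotZl dotZr mulrC; congr (_ * _); exact: dotC.
Qed.

Lemma adjointP (T : H -> H) : linear T ->
  bounded_op (adjoint dot T) /\
  forall x y, dot (T x) y = dot x (adjoint dot T y).
Proof.
move=> /adjoint_exists exS; rewrite /adjoint.
by case: xgetP => [S -> //|/= abs]; have [S hS] := exS; case: (abs S).
Qed.

Lemma adjoint_eq (T S : H -> H) : linear T ->
  (forall x y, dot (T x) y = dot x (S y)) -> adjoint dot T = S.
Proof.
move=> /adjointP[_ hA] hS; apply/funext => y.
apply: (dot_inj (dot := dot)) => z.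
by rewrite dotC [in RHS]dotC -hA -hS.
Qed.

End Basis.
End FiniteDimension.

(** * Integration over a finite set *)

Section FiniteSetIntegral.
Context d (T : measurableType d) (R : realType).
Variable mu : {measure set T -> \bar R}.
Local Open Scope ereal_scope.

Lemma set_seqE (I : eqType) (s : seq I) :
  [set` s] = \big[setU/set0]_(t <- s) [set t].
Proof.
elim: s => [|h s ih]; first by rewrite big_nil; apply/seteqP; split.
rewrite big_cons -ih; apply/seteqP; split=> x /=; rewrite inE.
  by move=> /orP[/eqP->|xs]; [left|right].
by case=> [->|->]; rewrite ?eqxx ?orbT.
Qed.

Lemma measurable_set_seq (s : seq T) :
  (forall t : T, measurable [set t]) -> measurable [set` s].
Proof. by move=> m1; rewrite set_seqE; apply: bigsetU_measurable. Qed.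

Lemma measurable_fun_set_seq (s : seq T) (f : T -> R) :
  (forall t : T, measurable [set t]) -> measurable_fun [set` s] f.
Proof.
move=> m1 _ Y mY.
rewrite (_ : _ `&` _ = [set` [seq x <- s | f x \in Y]]); last first.
  apply/seteqP; split => x /=; rewrite mem_filter.
    by case=> -> /mem_set ->.
  by move=> /andP[/set_mem].
exact: measurable_set_seq.
Qed.

Lemma Rintegral_set_seq (s : seq T) (f : T -> R) : uniq s ->
  (forall t : T, measurable [set t]) ->
  (forall t : T, mu [set t] \is a fin_num) ->
  (\int[mu]_(x in [set` s]) f x = \sum_(t <- s) f t * fine (mu [set t]))%R.
Proof.
move=> us m1 mufin; rewrite /Rintegral.
have -> : \int[mu]_(x in [set` s]) (f x)%:E =
          \sum_(t <- s) \int[mu]_(x in [set t]) (f x)%:E.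
  rewrite set_seqE integral_bigsetU_EFin // -?set_seqE.
    by move=> i j _ _ [x [/= -> ->]].
  by apply/measurable_EFinP; exact: measurable_fun_set_seq.
have h t : \int[mu]_(x in [set t]) (f x)%:E = (f t * fine (mu [set t]))%:E.
  rewrite EFinM fineK //.
  rewrite (eq_integral (fun=> (f t)%:E)); last first.
    by move=> x; rewrite inE /= => ->.
  by rewrite integral_cst.
by rewrite (eq_bigr _ (fun t _ => h t)) sumEFin.
Qed.

End FiniteSetIntegral.

Section FiniteSupport.
Context d (T : measurableType d) (R : realType).
Hypothesis m1 : forall t : T, measurable [set t].
Variables (s : seq T) (f : T -> R).
Hypothesis f0 : forall t, t \notin s -> f t = 0.

Let fE : f = f \_ [set` s].
Proof.
apply/funext => t; rewrite patchE; case: ifPn => // /negP nt.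
by rewrite f0 //; apply/negP => ts; apply: nt; rewrite inE.
Qed.

Lemma measurable_finite_support : measurable_fun setT f.
Proof.
rewrite fE; apply/(measurable_restrictT _ _).1; first exact: measurable_set_seq.
exact: measurable_fun_set_seq.
Qed.

Lemma bounded_finite_support t : `|f t| <= \sum_(u <- s) `|f u|.
Proof.
have [ts|/f0 ->] := boolP (t \in s); last by rewrite normr0; apply: sumr_ge0.
by rewrite (big_rem t) //= lerDl sumr_ge0.
Qed.

Lemma Rintegral_finite_support (mu : {measure set T -> \bar R}) : uniq s ->
  (forall t : T, mu [set t] \is a fin_num) ->
  \int[mu]_(x in setT) f x = \sum_(t <- s) f t * fine (mu [set t]).
Proof.
by move=> us mufin; rewrite -Rintegral_set_seq // [RHS]Rintegral_mkcond -fE.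
Qed.

End FiniteSupport.

(** * Diagonal operators and their spectrum *)

Section Diagonal.
Context {R : realType} {H : completeNormedModType R[i]}.
Variable dot : {dot H for (@Num.conj R[i])}.
Hypothesis hH : hilbert dot.

(** Over the complex numbers the quadratic form determines the operator. *)
Lemma polarization (A B : H -> H) : linear A -> linear B ->
  (forall x, dot (A x) x = dot (B x) x) -> A = B.
Proof.
move=> /linearP_op[AD _ AZ _] /linearP_op[BD _ BZ _] AB.
apply/funext => x; apply: (dot_inj (dot := dot)) => y.
(* Evaluate at x + y and at x + iy. *)
have h u v : dot (A u) v + dot (A v) u = dot (B u) v + dot (B v) u.
  have := AB (u + v); rewrite AD BD !dotDl !dotDr !AB.
  by rewrite -!addrA => /addrI; rewrite !addrA => /addIr.
have h1 := h x y; have := h x ('i%C *: y).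
rewrite AZ BZ !dotZr !dotZl.
rewrite (_ : ('i%C^*)%C = - 'i%C :> R[i]); last first.
  by apply/eqP; rewrite eq_complex /= oppr0 !eqxx.
rewrite !mulNr ![- _ + _]addrC -!mulrBr => /mulfI h2.
have i0 : ('i%C : R[i]) != 0 by rewrite eq_complex /= oner_eq0 andbF.
have {}h2 := h2 i0; apply: (@mulfI _ 2%:R); first by rewrite pnatr_eq0.
move: h1 h2; set a := dot (A x) y; set b := dot (A y) x.
set a' := dot (B x) y; set b' := dot (B y) x => h1 h2.
have -> : 2%:R * a = (a + b) - (b - a) by ring.
by rewrite h1 h2; ring.
Qed.

Variables (N : nat) (e : 'I_N -> H).
Hypothesis he : orthonormal_basis dot e.

(** The operator that is diagonal in the basis e with real eigenvalues p. *)
Definition diag (p : 'I_N -> R) : H -> H :=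
  lincomb dot e (fun i => (p i)%:C *: e i).

Lemma diagE p i : diag p (e i) = (p i)%:C *: e i.
Proof. exact: lincombE. Qed.

Lemma linear_diag p : linear (diag p).
Proof. exact: linear_lincomb. Qed.

Lemma bounded_diag p : bounded_op (diag p).
Proof. by apply: (linear_bounded hH he); exact: linear_diag. Qed.

Lemma dot_diagl p x y : dot (diag p x) y =
  \sum_i (p i)%:C * (dot x (e i) * ((dot y (e i))^*)%C).
Proof.
rewrite dot_suml; apply: eq_bigr => i _.
by rewrite !dotZl mulrCA (dotC dot y) conjcK.
Qed.

Lemma dot_diagr p x y : dot x (diag p y) = dot (diag p x) y.
Proof.
rewrite dotC !dot_diagl rmorph_sum; apply: eq_bigr => i _ /=.
rewrite !rmorphM /= oppr0 conjcK; congr (_ * _); exact: mulrC.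
Qed.

(** The number |<x, e_i>|^2, as a real number. *)
Definition weight (x : H) (i : 'I_N) : R :=
  complex.Re (dot x (e i)) ^+ 2 + complex.Im (dot x (e i)) ^+ 2.

Lemma weight_ge0 x i : 0 <= weight x i.
Proof. by rewrite addr_ge0 // sqr_ge0. Qed.

Lemma dot_diag p x : dot (diag p x) x = (\sum_i p i * weight x i)%:C.
Proof.
rewrite dot_diagl rmorph_sum; apply: eq_bigr => i _ /=.
by rewrite rmorphM /= /weight add_Re2_Im2 normCK.
Qed.

Lemma diag_comp p q : diag p \o diag q = diag (fun i => p i * q i).
Proof.
apply: (eq_linear_basis he).
- by move=> a x y /=; rewrite !linear_diag.
- exact: linear_diag.
- move=> i /=; rewrite !diagE.
  have [_ _ -> _] := linearP_op (linear_diag p).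
  by rewrite diagE scalerA -rmorphM mulrC.
Qed.

Lemma diag1 : diag (fun=> 1) = id.
Proof.
apply: (eq_linear_basis he); [exact: linear_diag | by [] |].
by move=> i; rewrite diagE scale1r.
Qed.

Lemma e_neq0 i : e i != 0.
Proof.
apply/eqP => ei0; have := he.1 i i; rewrite eqxx ei0 dot0l => /esym/eqP.
by rewrite oner_eq0.
Qed.

Lemma diag_positive p : (forall i, 0 <= p i) -> positive_op dot (diag p).
Proof.
move=> p0; split; first exact: bounded_diag.
move=> x; rewrite dot_diag ler0c; apply: sumr_ge0 => i _.
by rewrite mulr_ge0 // weight_ge0.
Qed.

Lemma spectrum_diag p : spectrum (diag p) = [set` undup (codom p)].
Proof.
apply/seteqP; split => s /=; rewrite mem_undup.
  move=> nI; apply: contrapT => /negP sp; apply: nI.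
  have ps i : p i - s != 0.
    by rewrite subr_eq0; apply: contraNneq sp => <-; exact: codom_f.
  exists (diag (fun i => (p i - s)^-1)).
  have -> : (fun x => diag p x - s%:C *: x) = diag (fun i => p i - s).
    apply: (eq_linear_basis he); [|exact: linear_diag|].
      move=> a x y; rewrite linear_diag scalerDr scalerBr !scalerA.
      by rewrite [s%:C * a]mulrC opprD addrACA.
    by move=> i; rewrite !diagE rmorphB scalerBl.
  split; first exact: bounded_diag.
  - rewrite diag_comp -[RHS]diag1; congr diag.
    by apply/funext => i; rewrite mulVf.
  - rewrite diag_comp -[RHS]diag1; congr diag.
    by apply/funext => i; rewrite mulfV.
move=> /codomP[i ->] [S [[lS _] SP _]].
have /(congr1 (fun F => F (e i))) /= := SP.
rewrite diagE subrr; have [_ _ _ ->] := linearP_op lS.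
by move/esym/eqP; rewrite (negPf (e_neq0 i)).
Qed.

End Diagonal.

(** * Spectral integrals of a diagonal operator *)

Section SpectralMeasure.
Context {R : realType} {H : completeNormedModType R[i]}.
Variable dot : {dot H for (@Num.conj R[i])}.
Hypothesis hH : hilbert dot.
Variables (N : nat) (e : 'I_N -> H).
Hypothesis he : orthonormal_basis dot e.
Variable p : 'I_N -> R.
Local Notation diag := (diag dot e).
Local Notation P := (diag p).

(* The distinct eigenvalues of P. *)
Let s : seq (measurableTypeR R) := undup (codom p).

Let m1 (t : measurableTypeR R) : measurable [set t].
Proof. exact: measurable_set1. Qed.

Lemma Rintegral_spectrum_diag
    (mu : {measure set (measurableTypeR R) -> \bar R}) a :
  (forall A, measurable A -> mu A \is a fin_num) ->
  \int[mu]_(t in spectrum P) a t = \sum_(t <- s) a t * fine (mu [set t]).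
Proof.
move=> mufin; rewrite (spectrum_diag hH he).
by apply: Rintegral_set_seq; rewrite ?undup_uniq // => t; apply: mufin.
Qed.

Lemma measurable_spectrum_diag :
  measurable (spectrum P : set (measurableTypeR R)).
Proof. by rewrite (spectrum_diag hH he); exact: measurable_set_seq. Qed.

Section Uniqueness.
Variables (E : set (measurableTypeR R) -> H -> H)
          (nu : H -> {measure set (measurableTypeR R) -> \bar R}).
Hypothesis hE : spectral_measure dot P E nu.

Let nu_fin x A : measurable A -> nu x A \is a fin_num.
Proof. by move=> mA; have [_ _ _ -> //] := hE. Qed.

Let dotEE x A : measurable A -> dot (E A x) (E A x) = dot (E A x) x.
Proof.
move=> mA; have [oE _ _ _ _] := hE; have [_ EE Esa] := oE _ mA.
by rewrite -[in RHS]EE /= [RHS]Esa.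
Qed.

Let dotE x A : measurable A -> dot (E A x) x = (fine (nu x A))%:C.
Proof.
move=> mA; have [_ _ _ -> //] := hE.
by rewrite -dotEE // RRe_real // ger0_real // dot_ge0.
Qed.

Let linE A : measurable A -> linear (E A).
Proof. by move=> mA; have [oE _ _ _ _] := hE; have [[]] := oE _ mA. Qed.

Let E0 : E set0 = fun=> 0.
Proof.
apply/funext => x; apply: (dot_eq0 (dot := dot)).
by rewrite dotEE // dotE // measure0.
Qed.

Lemma spectral_integral_sum a A : spectral_integral dot P nu a A ->
  A = fun x => \sum_(t <- s) (a t)%:C *: E [set t] x.
Proof.
move=> [[lA _] hA]; apply: (polarization (dot := dot) lA).
  move=> c x y; rewrite scaler_sumr -big_split; apply: eq_bigr => t _.
  by rewrite linE // scalerDr !scalerA mulrC.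
move=> x; rewrite hA Rintegral_spectrum_diag; last by move=> B; exact: nu_fin.
rewrite dot_suml rmorph_sum; apply: eq_bigr => t _.
by rewrite dotZl dotE // rmorphM.
Qed.

(** The projections of any spectral measure of P are the expected ones: they sum
    to the identity, and E{t} e_i = 0 for t != p_i since P E{t} = t E{t}. *)
Lemma spectral_proj_basis i t : E [set t] (e i) = (p i == t)%:R *: e i.
Proof.
have PE : P = fun x => \sum_(t <- s) t%:C *: E [set t] x.
  by apply: spectral_integral_sum; have [] := hE.
(* The identity is the spectral integral of the constant 1. *)
have IE : id = fun x => \sum_(t <- s) 1%:C *: E [set t] x.
  apply: (@spectral_integral_sum (fun=> 1)); split.
    exact: (linear_bounded hH he).
  move=> x; rewrite (@Rintegral_cst _ _ _ (nu x)); last first.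
    exact: measurable_spectrum_diag.
  rewrite mul1r -dotE; last exact: measurable_spectrum_diag.
  by have [_ -> _ _ _] := hE.
have EE u v x : E [set u] (E [set v] x) = (u == v)%:R *: E [set u] x.
  have [_ _ EI _ _] := hE.
  have := EI _ _ (m1 u) (m1 v) => /(congr1 (fun F => F x)) /= <-.
  case: eqVneq => [->|uv]; first by rewrite setIid scale1r.
  rewrite (_ : _ `&` _ = set0) ?E0 ?scale0r //.
  by apply/seteqP; split => // z [/= -> /eqP]; rewrite (negPf uv).
have key u : u \in s -> u != p i -> E [set u] (e i) = 0.
  move=> us upi.
  have h1 : E [set u] (P (e i)) = u%:C *: E [set u] (e i).
    rewrite {1}PE linear_sum_op; last exact: linE.
    rewrite (bigD1_seq u) ?undup_uniq //=.
    have [_ _ EZ _] := linearP_op (linE (m1 u)).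
    rewrite EZ EE eqxx scale1r big1_seq ?addr0 // => v /andP[vu _].
    by rewrite EZ EE eq_sym (negPf vu) scale0r scaler0.
  have [_ _ EZ _] := linearP_op (linE (m1 u)).
  move: h1; rewrite (diagE he) EZ => /eqP.
  rewrite -subr_eq0 -scalerBl scaler_eq0 -rmorphB /= => /orP[|/eqP//].
  by rewrite eq_complex /= subr_eq0 eq_sym (negPf upi).
have pis : p i \in s by rewrite mem_undup codom_f.
have Epi : E [set p i] (e i) = e i.
  have := congr1 (fun F => F (e i)) IE => /= /esym.
  rewrite (bigD1_seq (p i)) ?undup_uniq //= scale1r.
  rewrite big1_seq ?addr0 // => v /andP[vu vs].
  by rewrite key // scaler0.
case: eqVneq => [<-|tpi]; first by rewrite scale1r.
by rewrite -{1}Epi EE eq_sym (negPf tpi) !scale0r.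
Qed.

Lemma spectral_integral_unique a A : spectral_integral dot P nu a A ->
  A = diag (fun i => a (p i)).
Proof.
move=> hA; apply: (eq_linear_basis he).
- by case: hA => [[]].
- exact: linear_diag.
move=> i; rewrite (spectral_integral_sum hA) (diagE he).
rewrite (bigD1_seq (p i)) ?undup_uniq ?mem_undup ?codom_f //=.
rewrite spectral_proj_basis eqxx scale1r big1 ?addr0 // => t tpi.
by rewrite spectral_proj_basis eq_sym (negPf tpi) scale0r scaler0.
Qed.

End Uniqueness.
End SpectralMeasure.

(** * Double operator integrals with respect to a diagonal operator *)

Section DoubleOperatorIntegral.
Context {R : realType} {H : completeNormedModType R[i]}.
Variable dot : {dot H for (@Num.conj R[i])}.
Hypothesis hH : hilbert dot.
Variables (N : nat) (e : 'I_N -> H).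
Hypothesis he : orthonormal_basis dot e.
Variable p : 'I_N -> R.
Local Notation diag := (diag dot e).
Local Notation P := (diag p).

(** A double operator integral multiplies the matrix of X entrywise by the
    symbol (a Schur product), whatever spectral measure and factorization are
    used. *)
Lemma double_operator_integral_unique E nu phi (X D : H -> H) :
  spectral_measure dot P E nu -> linear X ->
  double_operator_integral dot P nu phi X D ->
  forall i j, dot (D (e j)) (e i) = (phi (p i) (p j))%:C * dot (X (e j)) (e i).
Proof.
move=> hE lX [_ [d [W [sigma [a [b [M [A [B [hab [hphi hA hB hD]]]]]]]]]]] i j.
have [ma mb bnd] := hab.
have [_ _ XZ _] := linearP_op lX.
have spec k : spectrum P (p k).
  by rewrite (spectrum_diag hH he) /= mem_undup codom_f.
pose g w := a (p i, w) * b (p j, w).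
have DE w : dot (A w (X (B w (e j)))) (e i) = (g w)%:C * dot (X (e j)) (e i).
  rewrite (spectral_integral_unique hH he hE (hA w)).
  rewrite (spectral_integral_unique hH he hE (hB w)).
  rewrite -(dot_diagr dot e) !(diagE he) XZ dotZr dotZl conjc_real mulrA.
  by rewrite -rmorphM.
have intg : sigma.-integrable setT (EFin \o g).
  apply: measurable_bounded_integrable => //.
  - by rewrite -ge0_fin_numE // fin_num_measure.
  - apply: measurable_funM.
      exact: (measurableT_comp ma (pair1_measurable (p i))).
    exact: (measurableT_comp mb (pair1_measurable (p j))).
  - exists (M * M); split; first exact: num_real.
    move=> K /ltW MK w _ /=; apply: le_trans MK.
    by rewrite normrM ler_pM // ?(bnd _).1 ?(bnd _).2.
rewrite hD /Cintegral.
under eq_Rintegral do rewrite DE.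
under [X in _ +i* X]eq_Rintegral do rewrite DE.
case: (dot (X (e j)) (e i)) => u v /=.
under eq_Rintegral do rewrite mul0r subr0.
under [X in _ +i* X]eq_Rintegral do rewrite mul0r addr0.
rewrite !RintegralZr //.
have -> : phi (p i) (p j) = \int[sigma]_w g w by exact: hphi.
by apply/eqP; rewrite eq_complex /= !mul0r subr0 addr0 !eqxx.
Qed.

End DoubleOperatorIntegral.

Section Existence.
Context {R : realType} {H : completeNormedModType R[i]}.
Variable dot : {dot H for (@Num.conj R[i])}.
Hypothesis hH : hilbert dot.
Variables (N : nat) (e : 'I_N -> H).
Hypothesis he : orthonormal_basis dot e.
Variable p : 'I_N -> R.
Local Notation diag := (diag dot e).
Local Notation P := (diag p).
Local Notation weight := (weight dot e).

(** The k-th atom of the scalar spectral measure of x: mass |<x, e_k>|^2 at p_k,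
    and the zero measure for k >= N. *)
Definition atom (x : H) (k : nat) :
    {measure set (measurableTypeR R) -> \bar R} :=
  if insub k is Some i
  then mscale (NngNum (weight_ge0 dot e x i))
              (@dirac _ (measurableTypeR R) (p i) R)
  else mzero.

(** The scalar spectral measure of P at x. *)
Definition diag_measure (x : H) : {measure set (measurableTypeR R) -> \bar R} :=
  msum (atom x) N.

(** The spectral projection of P on A. *)
Definition diag_proj (A : set (measurableTypeR R)) : H -> H :=
  diag (fun i => \1_A (p i)).

Lemma diag_measureE x A :
  (diag_measure x A = (\sum_i weight x i * \1_A (p i))%:E)%E.
Proof.
rewrite /diag_measure /= /msum -sumEFin; apply: eq_bigr => i _.
by rewrite /atom valK /= /mscale /= diracE indicE EFinM.
Qed.

Let m1 (t : measurableTypeR R) : measurable [set t].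
Proof. exact: measurable_set1. Qed.

Lemma spectral_integral_diag a :
  spectral_integral dot P diag_measure a (diag (fun i => a (p i))).
Proof.
split; first exact: bounded_diag.
move=> x; rewrite dot_diag; congr (_%:C).
rewrite (Rintegral_spectrum_diag hH he); last first.
  by move=> A _; rewrite diag_measureE.
under [RHS]eq_bigr => t _ do rewrite diag_measureE /= mulr_sumr.
rewrite exchange_big /=; apply: eq_bigr => i _.
rewrite (bigD1_seq (p i)) ?undup_uniq ?mem_undup ?codom_f //=.
rewrite indicE classical_sets.in_set1 eqxx mulr1 big1 ?addr0 // => t tpi.
by rewrite indicE classical_sets.in_set1 eq_sym (negPf tpi) !mulr0.
Qed.

Lemma spectral_measure_diag : spectral_measure dot P diag_proj diag_measure.
Proof.
split.
- move=> A mA; split; first exact: bounded_diag.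
    rewrite diag_comp //; congr diag; apply/funext => i.
    by rewrite indicE -natrM mulnb andbb.
  by move=> x y; rewrite dot_diagr.
- rewrite /diag_proj -[RHS](diag1 he); congr diag; apply/funext => i.
  by rewrite indicE mem_set // (spectrum_diag hH he) /= mem_undup codom_f.
- move=> A B mA mB; rewrite /diag_proj diag_comp //; congr diag.
  by apply/funext => i; rewrite indicI.
- move=> x A mA; rewrite diag_measureE dot_diag /=; congr (_%:E).
  by apply: eq_bigr => i _; rewrite mulrC.
- exact: (spectral_integral_diag idfun).
Qed.

Let s : seq (measurableTypeR R) := undup (codom p).

(** The counting measure of the spectrum of P. *)
Definition spectrum_atoms (A : set (measurableTypeR R)) : \bar R :=
  (msum (fun k => @dirac _ (measurableTypeR R) (nth 0 s k) R) (size s) A).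
HB.instance Definition _ := Measure.copy spectrum_atoms
  (msum (fun k => @dirac _ (measurableTypeR R) (nth 0 s k) R) (size s)).

Lemma spectrum_atomsE A : spectrum_atoms A = (\sum_(t <- s) \1_A t)%:E.
Proof.
rewrite /spectrum_atoms /msum (big_nth 0) big_mkord -sumEFin.
by apply: eq_bigr => i _ /=; rewrite diracE indicE.
Qed.

Let spectrum_atoms_fin : fin_num_fun spectrum_atoms.
Proof. by move=> A _; rewrite spectrum_atomsE. Qed.
HB.instance Definition _ :=
  @Measure_isFinite.Build _ _ _ spectrum_atoms spectrum_atoms_fin.

Lemma Rintegral_spectrum_atoms (f : measurableTypeR R -> R) :
  (forall t, t \notin s -> f t = 0) ->
  \int[spectrum_atoms]_w f w = \sum_(t <- s) f t.
Proof.
move=> f0; rewrite (Rintegral_finite_support m1 f0) ?undup_uniq //; last first.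
  by move=> t; apply: spectrum_atoms_fin; exact: m1.
rewrite big_seq [RHS]big_seq; apply: eq_bigr => t ts.
have -> : fine (spectrum_atoms [set t]) = 1; last by rewrite mulr1.
rewrite spectrum_atomsE (bigD1_seq t) ?undup_uniq //=.
rewrite indicE classical_sets.in_set1 eqxx big1 ?addr0 // => u ut.
by rewrite indicE classical_sets.in_set1 (negPf ut).
Qed.

(** The operator whose matrix in the basis e is the Schur product of the matrix
    of X and of phi(p_i, p_j). *)
Definition double_diag (phi : R -> R -> R) (X : H -> H) : H -> H :=
  lincomb dot e (fun j =>
    \sum_i ((phi (p i) (p j))%:C * dot (X (e j)) (e i)) *: e i).

(** The symbol is factorized as the sum over the eigenvalues w of
    [s = w] phi(w, t), cut off outside the spectrum so as to be measurable and
    bounded. *)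
Lemma double_operator_integral_diag phi X : linear X ->
  double_operator_integral dot P diag_measure phi X (double_diag phi X).
Proof.
move=> lX; split; first by apply: (linear_bounded hH he); exact: linear_lincomb.
pose a (z : measurableTypeR R * measurableTypeR R) : R :=
  ((z.1 == z.2) && (z.2 \in s))%:R.
pose b (z : measurableTypeR R * measurableTypeR R) : R :=
  if (z.1 \in s) && (z.2 \in s) then phi z.2 z.1 else 0.
pose ss : seq (measurableTypeR R * measurableTypeR R) :=
  [seq (x, y) | x <- s, y <- s].
have mss (t : measurableTypeR R * measurableTypeR R) : measurable [set t].
  case: t => u v; rewrite (_ : [set (u, v)] = [set u] `*` [set v]).
    exact: measurableX.
  by apply/seteqP; split => [[x y] [-> ->]|[x y] /= [-> ->]].
have ssE u v : ((u, v) \in ss) = (u \in s) && (v \in s).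
  apply/allpairsP/andP => [[[x y] /= [xs ys [-> ->]]] //|[us vs]].
  by exists (u, v).
have a0 z : z \notin ss -> a z = 0.
  case: z => u v; rewrite ssE /a /=; case: eqP => // <-.
  by rewrite andbb => /negPf ->.
have b0 z : z \notin ss -> b z = 0.
  by case: z => u v; rewrite ssE /b /= => /negPf ->.
pose M := \sum_(z <- ss) `|a z| + \sum_(z <- ss) `|b z|.
pose A w := diag (fun i => a (p i, w)).
pose B w := diag (fun i => b (p i, w)).
exists _, (measurableTypeR R), spectrum_atoms, a, b, M, A, B; split; split.
- exact: (measurable_finite_support mss a0).
- exact: (measurable_finite_support mss b0).
- move=> z; split.
    by rewrite (le_trans (bounded_finite_support a0 z)) // lerDl sumr_ge0.
  by rewrite (le_trans (bounded_finite_support b0 z)) // lerDr sumr_ge0.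
- move=> u v; rewrite (spectrum_diag hH he) /= => us vs.
  rewrite Rintegral_spectrum_atoms.
    rewrite (bigD1_seq u) ?undup_uniq //= /a /b /= eqxx us vs mul1r.
    by rewrite big1 ?addr0 // => t tu; rewrite eq_sym (negPf tu) mul0r.
  by move=> t ts; rewrite /a /= (negPf ts) andbF mul0r.
- by move=> w; exact: spectral_integral_diag.
- by move=> w; exact: spectral_integral_diag.
- move=> x y.
  have z0 t : t \notin s -> dot (A t (X (B t x))) y = 0.
    move=> ts; rewrite (_ : A t = fun=> 0) ?dot0l //.
    apply: (eq_linear_basis he); first exact: linear_diag.
      by move=> c u v; rewrite scaler0 addr0.
    by move=> i; rewrite /A (diagE he) /a /= (negPf ts) andbF scale0r.
  rewrite /Cintegral !Rintegral_spectrum_atoms; try by move=> t /z0 ->.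
  transitivity (\sum_(t <- s) dot (A t (X (B t x))) y); last first.
    elim: (s) => [|h t ih]; first by rewrite !big_nil.
    by rewrite !big_cons ih; case: (dot _ _).
  rewrite -dot_suml; congr (dot _ y).
  apply: (congr1 (fun F : H -> H => F x) (x := double_diag phi X)
                 (y := fun x => \sum_(t <- s) A t (X (B t x)))).
  apply: (eq_linear_basis he); first exact: linear_lincomb.
    move=> c u v; rewrite scaler_sumr -big_split; apply: eq_bigr => t _ /=.
    by rewrite /A /B linear_diag lX linear_diag.
  move=> j; rewrite /double_diag (lincombE he).
  have [_ _ XZ _] := linearP_op lX.
  transitivity (\sum_(t <- s) \sum_i
      ((phi t (p j))%:C * dot (X (e j)) (e i) * (p i == t)%:R) *: e i).
    rewrite exchange_big /=; apply: eq_bigr => i _.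
    rewrite (bigD1_seq (p i)) ?undup_uniq ?mem_undup ?codom_f //= eqxx mulr1.
    rewrite big1 ?addr0 // => t tpi.
    by rewrite eq_sym (negPf tpi) mulr0 scale0r.
  rewrite big_seq [RHS]big_seq; apply: eq_bigr => t ts.
  have [_ _ AZ _] := linearP_op (linear_diag dot e (fun i => a (p i, t))).
  rewrite /A /B (diagE he) XZ AZ /diag /lincomb scaler_sumr.
  apply: eq_bigr => i _; rewrite !scalerA /a /b /= ts.
  have -> : p j \in s by rewrite mem_undup codom_f.
  by rewrite rmorph_nat andbT [in RHS]andbT.
Qed.

Lemma double_diagE phi X D : linear D ->
  (forall i j,
     dot (D (e j)) (e i) = (phi (p i) (p j))%:C * dot (X (e j)) (e i)) ->
  D = double_diag phi X.
Proof.
move=> lD hD; apply: (eq_linear_basis he) => //; first exact: linear_lincomb.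
move=> j; rewrite /double_diag (lincombE he) [LHS](he.2 (D (e j))).
by apply: eq_bigr => i _; rewrite hD.
Qed.

End Existence.

(** * The Aluthge transform of U Q with Q diagonal *)

Section AluthgeDiagonal.
Context {R : realType} {H : completeNormedModType R[i]}.
Variable dot : {dot H for (@Num.conj R[i])}.
Hypothesis hH : hilbert dot.
Variables (N : nat) (e : 'I_N -> H).
Hypothesis he : orthonormal_basis dot e.
Local Notation diag := (diag dot e).

Section Polar.
Variables (U : H -> H) (q : 'I_N -> R).
Hypothesis hU : unitary_op dot U.
Hypothesis q0 : forall i, 0 < q i.

Let lU : linear U.
Proof. by case: hU => [[]]. Qed.

Let adjoint_Uq : adjoint dot (U \o diag q) = diag q \o adjoint dot U.
Proof.
apply: (adjoint_eq hH he) => [a x y|x y] /=; first by rewrite linear_diag lU.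
by rewrite (adjointP hH he lU).2 (dot_diagr dot e).
Qed.

Let adjoint_Uq_Uq :
  adjoint dot (U \o diag q) \o (U \o diag q) = diag q \o diag q.
Proof.
rewrite adjoint_Uq; have [_ UU _] := hU.
by apply/funext => x /=; rewrite -[in RHS](congr1 (fun F => F (diag q x)) UU).
Qed.

Lemma polar_diag : polar dot (U \o diag q) U (diag q).
Proof.
by split=> //; apply: (diag_positive hH he) => i; exact: ltW.
Qed.

(** Uniqueness of the polar decomposition. Any positive square root Q of the
    square of [diag q] agrees with [diag q] on e_i: for v = Q e_i - q_i e_i one
    has Q v = - q_i v, so v = 0 by positivity. *)
Lemma polar_diag_unique V Q :
  polar dot (U \o diag q) V Q -> V = U /\ Q = diag q.
Proof.
move=> [[[lV _] _ _] [[lQ _] Q0] QQ TVQ].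
have QE : Q = diag q.
  apply: (eq_linear_basis he) => //; first exact: linear_diag.
  move=> i; rewrite (diagE he); apply/eqP; rewrite -subr_eq0; apply/eqP.
  set v := Q (e i) - _.
  have [_ QB QZ _] := linearP_op lQ.
  have Qv : Q v = - ((q i)%:C *: v).
    have := congr1 (fun F => F (e i)) QQ.
    rewrite adjoint_Uq_Uq /= (diagE he).
    have [_ _ -> _] := linearP_op (linear_diag dot e q).
    rewrite (diagE he) /v QB QZ => ->.
    by rewrite scalerBr opprB.
  have := Q0 v; rewrite Qv -scaleNr dotZl mulNr oppr_ge0 => le0.
  apply: (dot_eq0 (dot := dot)); apply/eqP; rewrite eq_le dot_ge0 andbT.
  by rewrite -(pmulr_rle0 _ (x := (q i)%:C)) // ltcR.
split=> //; apply: (eq_linear_basis he) => // i.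
have [_ _ VZ _] := linearP_op lV; have [_ _ UZ _] := linearP_op lU.
have := congr1 (fun F => F (e i)) TVQ.
rewrite QE /= (diagE he) VZ UZ => /(scalerI _) -> //.
by rewrite eq_complex /= eqxx andbT gt_eqF.
Qed.

Lemma aluthge_diag f : aluthge dot f (U \o diag q) =
  double_diag dot e q (fun s t => s * f (t / s)) U.
Proof.
rewrite /aluthge; case: xgetP => [D -> | abs].
  move=> [V [Q [E [nu [hpol hE hD]]]]].
  have [VE QE] := polar_diag_unique hpol; rewrite VE QE in hE hD.
  apply: (double_diagE he); first by case: hD => [[]].
  exact: (double_operator_integral_unique hH he hE lU hD).
case: (abs (double_diag dot e q (fun s t => s * f (t / s)) U)).
exists U, (diag q), (diag_proj dot e q), (diag_measure dot e q); split.
- exact: polar_diag.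
- exact: spectral_measure_diag.
- exact: double_operator_integral_diag.
Qed.

(** If the symbol depends only on the column j on the support of the matrix of
    U, the Schur product with U is U times a diagonal operator. *)
Lemma double_diag_comp phi (q' : 'I_N -> R) :
  (forall i j, dot (U (e j)) (e i) != 0 -> phi (q i) (q j) = q' j) ->
  double_diag dot e q phi U = U \o diag q'.
Proof.
move=> h; apply/esym/(double_diagE he) => [a x y /=|i j].
  by rewrite linear_diag lU.
have [_ _ UZ _] := linearP_op lU.
rewrite /= (diagE he) UZ dotZl.
have [->|/h -> //] := eqVneq (dot (U (e j)) (e i)) 0; by rewrite !mulr0.
Qed.

End Polar.
End AluthgeDiagonal.

(** * Lazy averaging along a permutation *)

Lemma cvg_sum (K : numFieldType) (V : normedModType K) I (s : seq I)
    (F : I -> nat -> V) (a : I -> V) :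
  (forall i, F i n @[n --> \oo] --> a i) ->
  \sum_(i <- s) F i n @[n --> \oo] --> \sum_(i <- s) a i.
Proof.
move=> cF; elim: s => [|i s ih].
  by under eq_fun do rewrite big_nil; rewrite big_nil; exact: cvg_cst.
under eq_fun do rewrite big_cons.
by rewrite big_cons; apply: cvgD.
Qed.

Section LazyAverage.
Variables (R : realType) (N : nat) (tau : {perm 'I_N}).

(** The mean of h over the tau-orbit of i, computed along the powers of tau
    below its order: every point of the orbit is met equally often. *)
Definition orbit_mean (h : 'I_N -> R) (i : 'I_N) : R :=
  (\sum_(k < #[tau]%g) h ((tau ^+ k)%g i)) / #[tau]%g%:R.

Lemma orbit_mean_perm h i : orbit_mean h (tau i) = orbit_mean h i.
Proof.
rewrite /orbit_mean; congr (_ / _).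
have ht : ((tau ^+ #[tau])%g i = (tau ^+ 0)%g i) by rewrite expg_order expg0.
have : (0 < #[tau]%g)%N by exact: order_gt0.
move: ht; case: (#[tau]%g) => // m ht _.
rewrite big_ord_recr [RHS]big_ord_recl /= -permM -expgS ht addrC; congr (_ + _).
by apply: eq_bigr => k _; rewrite -permM -expgS.
Qed.

Lemma orbit_mean_gt0 h i : (forall j, 0 < h j) -> 0 < orbit_mean h i.
Proof.
move=> h0; have := order_gt0 tau; rewrite /orbit_mean.
case: (#[tau]%g) => // m _; rewrite divr_gt0 ?ltr0n //.
by rewrite big_ord_recl ltr_pwDl // sumr_ge0 // => k _; exact: ltW.
Qed.

Variables (l : R) (h : nat -> 'I_N -> R).
Hypothesis l01 : 0 < l < 1.
Hypothesis hS : forall n i, h n.+1 i = (1 - l) * h n (tau i) + l * h n i.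

Lemma orbit_mean_lazy n i : orbit_mean (h n) i = orbit_mean (h 0%N) i.
Proof.
elim: n => // n <-.
transitivity ((1 - l) * orbit_mean (h n) (tau i) + l * orbit_mean (h n) i).
  rewrite /orbit_mean !mulrA -mulrDl !mulr_sumr -big_split /=; congr (_ / _).
  by apply: eq_bigr => k _; rewrite hS -!permM (commuteX k (commute_refl tau)).
by rewrite orbit_mean_perm -mulrDl subrK mul1r.
Qed.

Let E n := \sum_i (h n i) ^+ 2.

(* Energy identity, from
   ((1 - l) b + l a)^2 = (1 - l) b^2 + l a^2 - l (1 - l) (a - b)^2. *)
Let E_drop n : E n - E n.+1 = l * (1 - l) * \sum_i (h n i - h n (tau i)) ^+ 2.
Proof.
have Et : \sum_i (h n (tau i)) ^+ 2 = E n.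
  by rewrite /E [RHS](reindex_inj (@perm_inj _ tau)).
have -> : E n = (1 - l) * \sum_i (h n (tau i)) ^+ 2 + l * E n.
  by rewrite Et; ring.
rewrite /E !mulr_sumr -big_split -sumrB /=; apply: eq_bigr => i _.
by rewrite hS; ring.
Qed.

Let cvg_diff i : h n i - h n (tau i) @[n --> \oo] --> 0.
Proof.
have [l0 l1] := andP l01.
have c0 : 0 < l * (1 - l) by rewrite mulr_gt0 ?subr_gt0.
have dE n : E n.+1 <= E n.
  rewrite -subr_ge0 E_drop mulr_ge0 ?(ltW c0) ?sumr_ge0 // => j _.
  exact: sqr_ge0.
(* E is nonincreasing and nonnegative, so its increments tend to 0. *)
have cE : cvgn E.
  apply: nonincreasing_is_cvgn; first exact/nonincreasing_seqP.
  by exists 0 => _ [n _ <-]; apply: sumr_ge0 => j _; exact: sqr_ge0.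
have cD : (E n - E n.+1) / (l * (1 - l)) @[n --> \oo] --> 0.
  rewrite -(mul0r (l * (1 - l))^-1) -(subrr (limn E)).
  apply: cvgMl; apply: cvgB => //.
  by rewrite (cvg_shiftS E).
have cS : Num.sqrt ((E n - E n.+1) / (l * (1 - l))) @[n --> \oo] --> 0.
  by rewrite -(sqrtr0 R); apply: continuous_cvg => //; exact: sqrt_continuous.
apply: (squeeze_cvgr _ _ cS); last first.
  by rewrite -oppr0; apply: cvgN; exact: cS.
near=> n; rewrite -ler_norml -sqrtr_sqr ler_wsqrtr // E_drop.
rewrite mulrAC divff ?gt_eqF // mul1r (bigD1 i) //= lerDl.
by apply: sumr_ge0 => j _; exact: sqr_ge0.
Unshelve. all: by end_near. Qed.

Lemma cvg_lazy_average i : h n i @[n --> \oo] --> orbit_mean (h 0%N) i.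
Proof.
have cvg_iter k : h n i - h n ((tau ^+ k)%g i) @[n --> \oo] --> 0.
  elim: k => [|k ih].
    rewrite (_ : (fun n => _) = fun=> 0); first exact: cvg_cst.
    by apply/funext => n; rewrite expg0 perm1 subrr.
  rewrite -(addr0 0).
  rewrite (_ : (fun n => _) = fun n => (h n i - h n ((tau ^+ k)%g i)) +
     (h n ((tau ^+ k)%g i) - h n (tau ((tau ^+ k)%g i)))); last first.
    by apply/funext => n; rewrite addrA subrK expgSr permM.
  by apply: cvgD => //; exact: cvg_diff.
have p0 : (#[tau]%g)%:R != 0 :> R by rewrite pnatr_eq0 -lt0n order_gt0.
rewrite -[X in _ --> X]add0r.
rewrite (_ : (fun n => _) = fun n =>
   (\sum_(k < #[tau]%g) (h n i - h n ((tau ^+ k)%g i))) / #[tau]%g%:R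
     + orbit_mean (h 0%N) i); last first.
  apply/funext => n.
  rewrite sumrB sumr_const card_ord mulrBl -(orbit_mean_lazy n).
  by rewrite -[h n i *+ _]mulr_natr mulfK // subrK.
apply: cvgD; last exact: cvg_cst.
rewrite -[X in _ --> X](mul0r (#[tau]%g%:R^-1)); apply: cvgMl.
have := @cvg_sum R R^o _ (index_enum 'I_#[tau]%g)
  (fun k n => h n i - h n ((tau ^+ k)%g i)) (fun=> 0) (fun k => cvg_iter k).
by rewrite big1_eq.
Qed.

End LazyAverage.

(** * Iterated power means *)

Section PowerMean.
Variables (R : realType) (N : nat) (tau : {perm 'I_N}) (r : R).
Hypothesis r0 : r != 0.

Lemma power_mean_gt0 (l x : R) : 0 < l < 1 -> 0 < power_mean r l x.
Proof.
move=> /andP[l0 l1]; apply: powR_gt0; rewrite ltr_pwDl ?subr_gt0 //.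
by rewrite mulr_ge0 ?(ltW l0) // powR_ge0.
Qed.

(** The r-th power turns the power mean into an arithmetic mean. *)
Lemma power_mean_powR (l s t : R) : 0 < l < 1 -> 0 < s -> 0 < t ->
  (s * power_mean r l (t / s)) `^ r = (1 - l) * s `^ r + l * t `^ r.
Proof.
move=> l01 s0 t0; have [l0 l1] := andP l01.
have c0 : 0 <= 1 - l + l * (t / s) `^ r.
  by rewrite addr_ge0 ?subr_ge0 ?(ltW l1) // mulr_ge0 ?(ltW l0) // powR_ge0.
rewrite powRM ?(ltW s0) ?(ltW (power_mean_gt0 _ _)) //.
rewrite /power_mean -powRrM mulVf // powRr1 // mulrDr [_ * (1 - l)]mulrC.
congr (_ + _).
by rewrite mulrCA -powRM ?(ltW s0) ?divr_ge0 ?ltW // [s * _]mulrC divfK ?gt_eqF.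
Qed.

(** The eigenvalues of the n-th iterate: each step replaces q_i by the weighted
    power mean of q_{tau i} and q_i. *)
Fixpoint power_mean_iter (l : R) (q : 'I_N -> R) (n : nat) (i : 'I_N) : R :=
  if n is m.+1 then
    power_mean_iter l q m (tau i) *
      power_mean r l (power_mean_iter l q m i / power_mean_iter l q m (tau i))
  else q i.

Lemma power_mean_iter_gt0 (l : R) (q : 'I_N -> R) n i :
  0 < l < 1 -> (forall j, 0 < q j) ->
  0 < power_mean_iter l q n i.
Proof.
move=> l01 q0; elim: n i => //= n ih i.
by rewrite mulr_gt0 // power_mean_gt0.
Qed.

Lemma cvg_power_mean_iter (l : R) (q : 'I_N -> R) i :
  0 < l < 1 -> (forall j, 0 < q j) ->
  power_mean_iter l q n i @[n --> \oo] -->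
    (orbit_mean tau (fun j => q j `^ r) i) `^ r^-1.
Proof.
move=> l01 q0.
pose h n i := power_mean_iter l q n i `^ r.
have hS n j : h n.+1 j = (1 - l) * h n (tau j) + l * h n j.
  by rewrite /h /= power_mean_powR // power_mean_iter_gt0.
rewrite (_ : (fun n => _) = fun n => h n i `^ r^-1); last first.
  apply/funext => n.
  by rewrite /h -powRrM mulfV // powRr1 // ltW // power_mean_iter_gt0.
have c := @cvg_lazy_average _ _ _ _ _ l01 hS i.
have m0 : 0 < orbit_mean tau (h 0%N) i.
  by apply: orbit_mean_gt0 => j; apply: powR_gt0.
have cont : {for orbit_mean tau (h 0%N) i, continuous (fun x : R => x `^ r^-1)}.
  apply: differentiable_continuous; apply/derivable1_diffP.
  by apply: derivable_powR; rewrite in_itv /= andbT.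
exact: (@continuous_cvg _ _ _ _ _ (h ^~ i) (fun x : R => x `^ r^-1) _ cont c).
Qed.

End PowerMean.

(** * Joint diagonalization of commuting selfadjoint operators *)

(** A sequence in a finite-dimensional space lies in the span of finitely many
    of its terms; this reduces an infinite commuting family to a finite one. *)
Lemma span_prefix (K : fieldType) (V : vectType K) (v : nat -> V) :
  exists n, forall m, v m \in <<mkseq v n>>%VS.
Proof.
pose Q d := `[< exists n, \dim <<mkseq v n>> = d >].
have exQ : exists d, Q d.
  by exists (\dim <<mkseq v 0>>); apply/asboolP; exists 0%N.
have bQ d : Q d -> (d <= \dim {: V})%N.
  by move=> /asboolP[n <-]; apply: dimvS; exact: subvf.
case: (ex_maxnP exQ bQ) => d /asboolP[n nd] dmax.
exists n => m.
have nm : (<<mkseq v n>> <= <<mkseq v (maxn n m.+1)>>)%VS.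
  apply: sub_span => x /mapP[k]; rewrite mem_iota /= add0n => kn ->.
  by apply: map_f; rewrite mem_iota /= add0n leq_max kn.
have /eqP -> : <<mkseq v n>>%VS == <<mkseq v (maxn n m.+1)>>%VS.
  rewrite eqEdim nm nd /=; apply: dmax; apply/asboolP; by exists (maxn n m.+1).
by apply: memv_span; apply: map_f; rewrite mem_iota /= add0n leq_max ltnSn orbT.
Qed.

Section JointDiagonalization.
Local Open Scope sesquilinear_scope.

(** Commuting matrices are triangular in a common orthonormal basis, and a
    triangular Hermitian matrix is diagonal. *)
Lemma codiagonalization (C : numClosedFieldType) (n : nat)
    (M : nat -> 'M[C]_n) :
  (forall k, (M k)^t* = M k) -> (forall k l, M k *m M l = M l *m M k) ->
  exists2 Q : 'M[C]_n, Q \is unitarymx &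
    forall k i j, i != j -> (Q *m M k *m Q^t*) i j = 0.
Proof.
move=> Mh Mc; have [K hK] := span_prefix M.
have cM : {in mkseq M K &, forall A B, comm_mx A B}.
  by move=> X Y /mapP[k _ ->] /mapP[l _ ->]; exact: Mc.
have [Q Qu /allP Qt] := @cotrigonalization C n (mkseq M K) cM.
exists Q => // k i j ij.
have base m : (m < K)%N -> (Q *m M m *m Q^t*) i j = 0.
  move=> mK.
  have /Qt : M m \in mkseq M K by apply: map_f; rewrite mem_iota.
  move=> /is_trig_mxP; rewrite conjymx // => tr.
  have herm a b : (Q *m M m *m Q^t*) a b = Num.conj ((Q *m M m *m Q^t*) b a).
    have hX : (Q *m M m *m Q^t*)^t* = Q *m M m *m Q^t*.
      by rewrite !trmx_mul !map_mxM Mh trmxCK mulmxA.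
    by rewrite -[in LHS]hX [LHS]mxE [in LHS]mxE.
  have [lij|lji|/val_inj eij] := ltngtP i j; first exact: tr.
    by rewrite herm tr // conjC0.
  by rewrite eij eqxx in ij.
have := coord_span (X := in_tuple (mkseq M K)) (hK k) => ->.
rewrite mulmx_sumr mulmx_suml summxE big1 // => a _.
rewrite -scalemxAr -scalemxAl mxE.
have aK : (a < K)%N by rewrite -[X in (_ < X)%N](size_mkseq M).
by rewrite /= nth_mkseq // base // mulr0.
Qed.

Context {R : realType} {H : completeNormedModType R[i]}.
Variable dot : {dot H for (@Num.conj R[i])}.
Hypothesis hH : hilbert dot.

Lemma joint_eigenbasis (N : nat) (e0 : 'I_N -> H) (A : nat -> H -> H) :
  orthonormal_basis dot e0 -> (forall m, linear (A m)) ->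
  (forall m x y, dot (A m x) y = dot x (A m y)) ->
  (forall k l, A k \o A l = A l \o A k) ->
  exists e : 'I_N -> H, orthonormal_basis dot e /\
    exists beta : 'I_N -> nat -> R,
      forall i m, A m (e i) = (beta i m)%:C *: e i.
Proof.
move=> he0 lA sA cA.
(* Row i of M m contains the coordinates of A_m e0_i. *)
pose M m : 'M[R[i]]_N := \matrix_(i, j) dot (A m (e0 i)) (e0 j).
have ME m i : A m (e0 i) = \sum_j M m i j *: e0 j.
  by rewrite [LHS]he0.2; apply: eq_bigr => j _; rewrite mxE.
have MM k l i j : (M k *m M l) i j = dot (A l (A k (e0 i))) (e0 j).
  rewrite ME linear_sum_op // dot_suml !mxE; apply: eq_bigr => a _.
  by have [_ _ -> _] := linearP_op (lA l); rewrite dotZl !mxE.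
have Mh m : (M m)^t* = M m.
  by apply/matrixP => i j; rewrite !mxE sA; exact/esym/dotC.
have Mc k l : M k *m M l = M l *m M k.
  apply/matrixP => i j; rewrite !MM.
  by have /(congr1 (fun F => F (e0 i))) /= -> := cA l k.
have [Q Qu Qd] := codiagonalization Mh Mc.
have /unitarymxP QQ := Qu.
have QQ' : Q^t* *m Q = 1%:M by apply: mulmx1C.
pose e i := \sum_j Q i j *: e0 j.
have dot_e x i : dot x (e i) = \sum_j (Q i j)^* * dot x (e0 j).
  by rewrite dot_sumr; apply: eq_bigr => j _; rewrite dotZr.
exists e; split.
  split=> [i j|x].
    rewrite dot_e; have /matrixP/(_ i j) := QQ; rewrite !mxE => <-.
    apply: eq_bigr => a _; rewrite !mxE mulrC; congr (_ * _).
    rewrite dot_suml (bigD1 a) //= dotZl he0.1 eqxx mulr1.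
    rewrite big1 ?addr0 // => b ba.
    by rewrite dotZl he0.1 (negPf ba) mulr0.
  rewrite {1}(he0.2 x).
  transitivity (\sum_i \sum_j \sum_k
      ((Q i j)^* * dot x (e0 j) * Q i k) *: e0 k); last first.
    apply: eq_bigr => i _; rewrite dot_e scaler_suml; apply: eq_bigr => j _.
    by rewrite scaler_sumr; apply: eq_bigr => k _; rewrite scalerA.
  rewrite exchange_big /=; apply: eq_bigr => j _; rewrite exchange_big /=.
  transitivity (\sum_k (dot x (e0 j) * (j == k)%:R) *: e0 k).
    rewrite (bigD1 j) //= eqxx mulr1 big1 ?addr0 // => k kj.
    by rewrite eq_sym (negPf kj) mulr0 scale0r.
  apply: eq_bigr => k _; rewrite -scaler_suml; congr (_ *: _).
  have /matrixP/(_ j k) := QQ'; rewrite !mxE => <-.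
  by rewrite mulr_sumr; apply: eq_bigr => i _; rewrite !mxE mulrCA mulrA.
pose D m := Q *m M m *m Q^t*.
have Ae i m : A m (e i) = D m i i *: e i.
  have QM : Q *m M m = D m *m Q by rewrite /D mulmxKtV.
  rewrite linear_sum_op //.
  transitivity (\sum_k (Q *m M m) i k *: e0 k).
    under eq_bigr => j _.
      have [_ _ -> _] := linearP_op (lA m).
      rewrite ME scaler_sumr; over.
    rewrite exchange_big /=; apply: eq_bigr => k _.
    by rewrite mxE scaler_suml; apply: eq_bigr => j _; rewrite scalerA.
  rewrite QM scaler_sumr; apply: eq_bigr => k _; rewrite scalerA.
  congr (_ *: _).
  rewrite mxE (bigD1 i) //= big1 ?addr0 // => j ji.
  by rewrite Qd ?mul0r // eq_sym.
exists (fun i m => complex.Re (D m i i)) => i m.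
rewrite Ae RRe_real //; apply/CrealP.
have hX : (D m)^t* = D m by rewrite /D !trmx_mul !map_mxM Mh trmxCK mulmxA.
by rewrite -[in RHS]hX [RHS]mxE [in RHS]mxE.
Qed.

End JointDiagonalization.

(** Some term of the Leibniz formula of a nonzero determinant is nonzero. *)
Lemma unit_matrix_perm (F : comUnitRingType) (n : nat) (M : 'M[F]_n) :
  M \in unitmx -> exists s : {perm 'I_n}, forall i, M i (s i) != 0.
Proof.
rewrite unitmxE => Mu; apply: contrapT => ns.
have d0 : \det M = 0.
  rewrite /determinant big1 // => s _.
  have [i /negP/negPn/eqP Mi] : exists i, ~ (M i (s i) != 0).
    by apply/existsNP => hs; apply: ns; exists s.
  by rewrite (bigD1 i) //= Mi mul0r mulr0.
by rewrite d0 unitr0 in Mu.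
Qed.

(** * Compact invertible operators act on finite-dimensional spaces *)

Section Compact.
Context {R : realType} {H : completeNormedModType R[i]}.
Variable dot : {dot H for (@Num.conj R[i])}.
Hypothesis hH : hilbert dot.

Local Notation orthonormal_family := (orthonormal_family dot).

Lemma orthonormal_family_dist N (e : 'I_N -> H) i j : orthonormal_family e ->
  i != j -> `|e i - e j| ^+ 2 = 2.
Proof.
move=> he ij; rewrite hH dotBl !dotBr !he !eqxx (negPf ij) eq_sym (negPf ij).
by rewrite subr0 sub0r opprK.
Qed.

(** Two orthonormal vectors are at distance sqrt 2 > 1, so a ball of radius 1/2
    contains at most one of them. *)
Lemma orthonormal_family_bounded (D : {fset H}) :
  [set x : H | `|x| <= 1] `<=` cover [set` D] (fun x => ball x (2^-1 : R[i])) ->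
  forall N (e : 'I_N -> H), orthonormal_family e -> (N <= #|` D|)%N.
Proof.
move=> cov N e he.
have hx i : exists x, x \in D /\ `|x - e i| < 2^-1.
  have [|x /= xD] := cov (e i); last by rewrite -ball_normE /= => xe; exists x.
  by rewrite /= -(@ler_pXn2r _ 2%N) ?nnegrE // hH he eqxx expr1n.
pose f i := projT1 (cid (hx i)).
have fD i : f i \in D by rewrite /f; case: cid => x /= [].
have fe i : `|f i - e i| < 2^-1 by rewrite /f; case: cid => x /= [].
have finj : injective f.
  move=> i j fij; apply/eqP; apply/negP => /negP ij.
  have lt1 : `|e i - e j| < 1.
    rewrite -(subrK (f i) (e i)) -addrA (le_lt_trans (ler_normD _ _)) //.
    rewrite [X in _ < X](splitr 1) ltrD // ?div1r; first by rewrite distrC.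
    by rewrite fij.
  have := orthonormal_family_dist he ij.
  have : `|e i - e j| ^+ 2 < 1 by rewrite expr_lt1.
  by move=> + h2; rewrite h2 (ltr_nat _ 2 1).
have := @uniq_leq_size _ (map f (enum 'I_N)) (enum_fset D).
rewrite size_map size_enum_ord => -> //.
  by rewrite map_inj_uniq // enum_uniq.
by move=> x /mapP[i _ ->]; exact: fD.
Qed.

Lemma orthonormal_family_extend N (e : 'I_N -> H) (y : H) :
  orthonormal_family e -> y != 0 -> (forall i, dot y (e i) = 0) ->
  exists e' : 'I_N.+1 -> H, orthonormal_family e'.
Proof.
move=> he y0 ye.
have ny : `|y| != 0 by rewrite normr_eq0.
have u1 : dot (`|y|^-1 *: y) (`|y|^-1 *: y) = 1.
  rewrite dotZl dotZr -hH (_ : (_^*)%C = `|y|^-1).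
    by rewrite expr2 mulKf // mulVf.
  by apply/CrealP; rewrite realV ger0_real.
have ey i : dot (e i) y = 0 by rewrite dotC ye conjc0.
exists (fun i => if unlift ord_max i is Some j then e j else `|y|^-1 *: y).
move=> i j; case: (unliftP ord_max i) => [i'|] ->;
  case: (unliftP ord_max j) => [j'|] ->.
- by rewrite he (inj_eq lift_inj).
- by rewrite dotZr ey mulr0 eq_sym (negPf (neq_lift _ _)).
- by rewrite dotZl ye mulr0 (negPf (neq_lift _ _)).
- by rewrite u1 eqxx.
Qed.

(** An orthonormal family of maximal size is a basis. *)
Lemma orthonormal_basis_exists (B : nat) :
  (forall N (e : 'I_N -> H), orthonormal_family e -> (N <= B)%N) ->
  exists N (e : 'I_N -> H), orthonormal_basis dot e.
Proof.
move=> bnd; pose Q n := `[< exists e : 'I_n -> H, orthonormal_family e >].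
have exQ : exists n, Q n.
  by exists 0%N; apply/asboolP; exists (fun=> 0) => -[].
have bQ n : Q n -> (n <= B)%N by move=> /asboolP[e he]; exact: bnd he.
case: (ex_maxnP exQ bQ) => n /asboolP[e he] nmax.
exists n, e; split=> // x; apply/eqP; rewrite -subr_eq0; apply/negP => /negP y0.
have ye i : dot (x - \sum_j dot x (e j) *: e j) (e i) = 0.
  rewrite dotBl dot_suml (bigD1 i) //= dotZl he eqxx mulr1.
  rewrite big1 ?addr0 ?subrr // => j ji.
  by rewrite dotZl he (negPf ji) mulr0.
have [e' he'] := orthonormal_family_extend he y0 ye.
have : (n < n)%N by apply: nmax; apply/asboolP; exists e'.
by rewrite ltnn.
Qed.

Lemma compact_invertible_basis (T : H -> H) : compact_op T -> invertible_op T ->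
  exists N (e : 'I_N -> H), orthonormal_basis dot e.
Proof.
(* The unit ball lies in the compact image under S = T^-1 of the closure. *)
move=> cT [S [[lS cS] ST _]].
have cST : compact (S @` closure [set T x | x in [set x : H | `|x| <= 1]]).
  by apply: continuous_compact => //; exact: continuous_subspaceT.
move: cST; rewrite compact_cover.
move=> /(_ H setT (fun x => ball x (2^-1 : R[i]))) [].
- by move=> x _; exact: ball_open.
- by move=> x _; exists x => //; exact: ballxx.
- move=> D _ cov; apply: (@orthonormal_basis_exists #|` D|) => N e.
  apply: orthonormal_family_bounded => x x1; apply: cov.
  exists (T x); last by have /(congr1 (fun F => F x)) := ST.
  by apply: subset_closure; exists x.
Qed.

End Compact.

(** * Centered operators *)

Lemma cvg_real_complex (R : realType) (u : nat -> R) (l : R) :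
  u n @[n --> \oo] --> l ->
  ((u n)%:C : R[i]^o) @[n --> \oo] --> (l%:C : R[i]^o).
Proof.
move=> /cvgrPdist_lt ul; apply/cvgrPdist_lt => eps eps0.
have [ie re] : complex.Im eps = 0 /\ 0 < complex.Re eps.
  by move: eps0; rewrite ltcE /= => /andP[/eqP].
have := ul _ re; apply: filterS => n.
rewrite -rmorphB normc_def /= expr0n addr0 sqrtr_sqr => lt.
by rewrite ltcE /= ie eqxx.
Qed.

Section Centered.
Context {R : realType} {H : completeNormedModType R[i]}.
Variable dot : {dot H for (@Num.conj R[i])}.
Hypothesis hH : hilbert dot.
Variables (N : nat) (e0 : 'I_N -> H).
Hypothesis he0 : orthonormal_basis dot e0.

Lemma positive_selfadjoint (P : H -> H) : positive_op dot P ->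
  forall x y, dot (P x) y = dot x (P y).
Proof.
move=> [[lP _] P0] x y; have [[lA _] hA] := adjointP hH he0 lP.
rewrite hA; congr (dot x _); apply: (congr1 (fun F => F y)).
apply: (polarization (dot := dot) lA lP) => z.
rewrite dotC -hA; apply/CrealP; exact: ger0_real.
Qed.

Section Unitary.
Variables (U P : H -> H).
Hypothesis hU : unitary_op dot U.
Hypothesis hP : positive_op dot P.
Hypothesis Pinj : forall x, P x = 0 -> x = 0.
Hypothesis hcent : centered dot U P.

Local Notation V := (adjoint dot U).

(* A_m = U^*m P U^m. *)
Let A m := iter m V \o P \o iter m U.

Let lU : linear U. Proof. by case: hU => [[]]. Qed.
Let lV : linear V. Proof. by case: (adjointP hH he0 lU) => [[]]. Qed.
Let lP : linear P. Proof. by case: hP => [[]]. Qed.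
Let dotU x y : dot (U x) y = dot x (V y).
Proof. exact: (adjointP hH he0 lU).2. Qed.
Let dotV x y : dot (V x) y = dot x (U y).
Proof. by rewrite dotC -dotU [RHS]dotC. Qed.

Let linear_iter (F : H -> H) m : linear F -> linear (iter m F).
Proof. by move=> lF; elim: m => [|m ih] // a x y /=; rewrite ih lF. Qed.

Let lA m : linear (A m).
Proof.
move=> a x y; rewrite /A /= (linear_iter m lU) lP.
by rewrite (linear_iter m lV).
Qed.

Let sA m x y : dot (A m x) y = dot x (A m y).
Proof.
have iterV k u v : dot (iter k V u) v = dot u (iter k U v).
  by elim: k u v => // k ih u v; rewrite iterS dotV ih -iterSr.
have iterU k u v : dot (iter k U u) v = dot u (iter k V v).
  by elim: k u v => // k ih u v; rewrite iterS dotU ih -iterSr.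
by rewrite /A /= iterV (positive_selfadjoint hP) iterU.
Qed.

(* The index 0 is the separate case of centeredness: A_0 is P itself. *)
Let cA k l : A k \o A l = A l \o A k.
Proof.
by apply: hcent; [case: k => [|k]|case: l => [|l]];
  [left|right; exists k.+1 => //; left|left|right; exists l.+1 => //; left].
Qed.

Let UA m x : U (A m.+1 x) = A m (U x).
Proof.
have [_ _ UV] := hU.
rewrite /A /= -[U (iter m U x)]iterS iterSr.
exact: (congr1 (fun F => F (iter m V (P (iter m U (U x))))) UV).
Qed.

(** A common eigenbasis of the U^*m P U^m, with eigenvalues beta_i(m), in which
    U only connects e_j to the e_i with beta_i the shift of beta_j; the
    permutation tau selects one such i for each j. *)
Lemma centered_eigenbasis :
  exists (e : 'I_N -> H) (beta : 'I_N -> nat -> R) (tau : {perm 'I_N}),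
  [/\ orthonormal_basis dot e, P = diag dot e (fun i => beta i 0%N),
      forall i, 0 < beta i 0%N,
      forall i j, dot (U (e j)) (e i) != 0 -> forall m, beta i m = beta j m.+1 &
      forall i m, beta (tau i) m = beta i m.+1].
Proof.
have [e [he [beta hbeta]]] := joint_eigenbasis he0 lA sA cA.
have hUb i j : dot (U (e j)) (e i) != 0 -> forall m, beta i m = beta j m.+1.
  move=> Uij m; apply: complexI; apply: (mulIf Uij).
  have [_ _ UZ _] := linearP_op lU.
  rewrite -[RHS]dotZl -UZ -hbeta UA sA hbeta dotZr.
  by congr (_ * _); exact/esym/conjc_real.
pose M : 'M[R[i]]_N := \matrix_(i, j) dot (U (e i)) (e j).
have Mu : M \in unitmx.
  have /mulmx1_unit[] // : M *m (\matrix_(i, j) (dot (U (e j)) (e i))^*) = 1%:M.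
  apply/matrixP => i k; rewrite !mxE.
  transitivity (dot (U (e i)) (U (e k))).
    by rewrite (dot_basisE he); apply: eq_bigr => j _; rewrite !mxE.
  have [_ VU _] := hU.
  by rewrite dotU; have /(congr1 (fun F => F (e k))) /= -> := VU; rewrite he.1.
have [tau htau] := unit_matrix_perm Mu.
exists e, beta, tau; split => //.
- apply: (eq_linear_basis he) => //; first exact: linear_diag.
  by move=> i; rewrite (diagE he) -hbeta.
- move=> i; have Pe : P (e i) = (beta i 0%N)%:C *: e i by rewrite -hbeta.
  rewrite lt_neqAle; apply/andP; split.
    apply/eqP => b0; have := e_neq0 he i.
    by rewrite (Pinj (x := e i)) ?eqxx // Pe -b0 scale0r.
  by have := hP.2 (e i); rewrite Pe dotZl he.1 eqxx mulr1 ler0c.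
- by move=> i m; apply: hUb; have := htau i; rewrite mxE.
Qed.

End Unitary.
End Centered.

Section Limit.
Context {R : realType} {H : completeNormedModType R[i]}.
Variable dot : {dot H for (@Num.conj R[i])}.
Hypothesis hH : hilbert dot.

(** The iterates are U Q_n with Q_n diagonal, its eigenvalues being the iterated
    power means along tau. *)
Lemma centered_aluthge_limit (N : nat) (e0 : 'I_N -> H) (r : R)
    (T U P : H -> H) :
  orthonormal_basis dot e0 -> r != 0 -> invertible_op T ->
  polar dot T U P -> centered dot U P ->
  exists L : H -> H, bounded_op L /\
    forall lambda : R, 0 < lambda < 1 ->
      sot_cvg (fun n => iter n (aluthge dot (power_mean r lambda)) T) L.
Proof.
move=> he0 r0 [S [[lS _] ST _]] [hU hP _ TUP] hcent.
have lU : linear U by case: hU => [[]].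
have [_ _ UZ U0] := linearP_op lU.
have [_ _ _ S0] := linearP_op lS.
have Pinj x : P x = 0 -> x = 0.
  move=> Px; have := congr1 (fun F => F x) ST.
  by rewrite /= TUP /= Px U0 S0.
have [e [beta [tau [he PE q0 hUb hbt]]]] :=
  centered_eigenbasis hH he0 hU hP Pinj hcent.
pose q0' i := beta i 0%N.
pose m := fun i => (orbit_mean tau (fun j => q0' j `^ r) i) `^ r^-1.
exists (U \o diag dot e m); split.
  by apply: (linear_bounded hH he) => a x y /=; rewrite linear_diag lU.
move=> l l01.
pose q n := power_mean_iter tau r l q0' n.
have qpos n i : 0 < q n i by exact: power_mean_iter_gt0.
have qS n i : q n.+1 i =
    q n (tau i) * power_mean r l (q n i / q n (tau i)) by [].
have q_0 i : q 0%N i = beta i 0%N by [].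
have cvgq i : q n i @[n --> \oo] --> m i by exact: cvg_power_mean_iter.
clearbody q m.
(* The eigenvalues depend only on the sequence beta_i. *)
have qinv n i j : (forall k, beta i k = beta j k) -> q n i = q n j.
  elim: n i j => [|n ih] i j bij; first by rewrite !q_0.
  have btau k : beta (tau i) k = beta (tau j) k by rewrite !hbt.
  by rewrite qS [RHS]qS (ih _ _ bij) (ih _ _ btau).
have TnE n : iter n (aluthge dot (power_mean r l)) T = U \o diag dot e (q n).
  elim: n => [|n ih].
    rewrite /= TUP PE; congr (_ \o diag dot e _).
    by apply/funext => i; rewrite q_0.
  rewrite iterS ih (aluthge_diag hH he hU (qpos n)).
  apply: (double_diag_comp he hU) => i j Uij.
  have bij k : beta i k = beta (tau j) k by rewrite hbt; exact: hUb.
  by rewrite qS (qinv n _ _ bij).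
move=> x; under eq_fun do rewrite TnE.
have UdE p : (U \o diag dot e p) x =
    \sum_i (p i)%:C *: (dot x (e i) *: U (e i)).
  rewrite /= /diag /lincomb linear_sum_op //; apply: eq_bigr => i _.
  by rewrite !UZ !scalerA mulrC.
under eq_fun do rewrite UdE.
rewrite UdE; apply: cvg_sum => i; apply: cvgZr_tmp.
by apply: cvg_real_complex; exact: cvgq.
Qed.

End Limit.

Theorem theorem6p3 (R : realType) (H : completeNormedModType R[i])
    (dot : {dot H for (@Num.conj R[i])}) (hH : hilbert dot)
    (r : R) (hr : -1 <= r <= 1) (hr0 : r != 0)
    (T U P : H -> H) (hT : bounded_op T) (hTinv : invertible_op T)
    (hpolar : polar dot T U P) (hcent : centered dot U P)
    (hK : compact_op T \/ matrix_op dot T) :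
  exists L : H -> H, bounded_op L /\
    forall lambda : R, 0 < lambda < 1 ->
      sot_cvg (fun n => iter n (aluthge dot (power_mean r lambda)) T) L.
Proof.
have [N [e he]] : exists N (e : 'I_N -> H), orthonormal_basis dot e.
  case: hK => [cT|[N [e [A [? ? _]]]]].
    exact: compact_invertible_basis hTinv.
  by exists N, e.
exact: (centered_aluthge_limit hH he hr0 hTinv hpolar hcent).
Qed.
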